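(* Let $(p^*(a),b^*(a))$ be the unique Nash equilibrium of the energy sharing game (defined in the context) with price sensitivity equal to $a<0$. Then $\sum_{i\in\mathcal{I}}f_i(p_i^*(a))$ is decreasing in $|a|$.
   Context: Energy sharing game. The players (prosumers) are $\mathcal{I}=\{1,\dots,N\}$, with $N\ge 2$. Prosumer $i$ has a given required load reduction $D_i$ with $\underline D\le D_i\le\overline D$, and a disutility function $f_i(p_i)=c_ip_i^2+d_ip_i$, where $0<\underline c\le c_i\le\overline c$ and $0<\underline d\le d_i\le\overline d$ (the underlined and overlined quantities are fixed bounds). All prosumers have the same price sensitivity $a<0$. Each prosumer $i$ chooses an output adjustment $p_i\in\mathbb{R}$ and a bid $b_i\in\mathbb{R}$. Given the bids $b=(b_1,\dots,b_N)$, the sharing price is $\lambda_c(b)=-\frac{1}{Na}\sum_{j=1}^N b_j$, which is equivalent to the market clearing condition $\sum_{i}(a\lambda_c(b)+b_i)=0$. Given the other prosumers' bids $b_{-i}$, prosumer $i$ minimizes $$\Pi_i(p_i,b_i,b_{-i})=c_ip_i^2+d_ip_i+(a\lambda_c(b)+b_i)\lambda_c(b)$$ over the action set $X_i(b_{-i})=\{(p_i,b_i)\in\mathbb{R}^2:\ p_i+a\lambda_c(b)+b_i=D_i\}$. A profile $(p^*,b^* )$ is a Nash equilibrium if for every $i\in\mathcal{I}$, $(p_i^*,b_i^* )\in X_i(b_{-i}^* )$ and $\Pi_i(p_i^*,b_i^*,b_{-i}^* )\le\Pi_i(p_i,b_i,b_{-i}^* )$ for all $(p_i,b_i)\in X_i(b_{-i}^*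 )$. For each $a<0$ this game has exactly one Nash equilibrium. In the claim, $N$ and all $c_i,d_i,D_i$ are held fixed while $a$ varies. *)

(* Defs.v *)
From mathcomp Require Import all_boot all_order all_algebra.
From mathcomp Require Import reals.

Set Implicit Arguments.
Unset Strict Implicit.
Unset Printing Implicit Defensive.

Import Order.TTheory GRing.Theory Num.Theory.
Local Open Scope ring_scope.

(* Prosumers are indexed by 'I_N, i.e. 0, ..., N-1 instead of 1, ..., N. *)

Definition disutility (R : realType) (c d p : R) : R := c * p ^+ 2 + d * p.

Definition sharing_price (R : realType) (N : nat) (a : R) (b : 'I_N -> R) : R :=
  - (1 / (N%:R * a)) * \sum_j b j.

(* The profile (x, b_{-i}). *)
Definition with_bid (R : realType) (N : nat) (b : 'I_N -> R) (i : 'I_N) (x : R)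
  : 'I_N -> R :=
  [eta b with i |-> x].

(* The arguments are p_i, b_i and a full profile b, of which only b_{-i}
   matters: its i-th entry is overwritten by b_i. *)
Definition player_cost (R : realType) (N : nat) (a : R) (c d : 'I_N -> R)
    (i : 'I_N) (pi bi : R) (b : 'I_N -> R) : R :=
  let lambda := sharing_price a (with_bid b i bi) in
  disutility (c i) (d i) pi + (a * lambda + bi) * lambda.

(* (p_i, b_i) \in X_i(b_{-i}), with the same convention on b. *)
Definition in_action_set (R : realType) (N : nat) (a : R) (D : 'I_N -> R)
    (i : 'I_N) (pi bi : R) (b : 'I_N -> R) : Prop :=
  pi + a * sharing_price a (with_bid b i bi) + bi = D i.

Definition nash_equilibrium (R : realType) (N : nat) (a : R)
    (c d D : 'I_N -> R) (p b : 'I_N -> R) : Prop :=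
  forall i : 'I_N,
    in_action_set a D i (p i) (b i) b /\
    forall pi bi : R, in_action_set a D i pi bi b ->
      player_cost a c d i (p i) (b i) b <= player_cost a c d i pi bi b.

Definition total_disutility (R : realType) (N : nat) (c d p : 'I_N -> R) : R :=
  \sum_i disutility (c i) (d i) (p i).

(* Main.v *)
Require Import Defs.
From mathcomp Require Import all_boot all_order all_algebra.
From mathcomp Require Import reals.
From mathcomp Require Import ring lra.

Set Implicit Arguments.
Unset Strict Implicit.
Unset Printing Implicit Defensive.

Import Order.TTheory GRing.Theory Num.Theory.
Local Open Scope ring_scope.

(** Write [q_i = D_i - p_i] for the amount that prosumer [i] buys at
    equilibrium and [lambda] for the price. A bid moves both the traded amount
    and the price, so the first-order condition of prosumer [i] is
      [2 c_i p_i + d_i = lambda + q_i / ((N - 1) |a|)],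
    in which the last term measures market power. Market clearing gives
    [sum_i p_i = sum_i D_i]. These are exactly the optimality conditions of
    the convex problem
      minimize [F(p) + t G(p)] subject to [sum_i p_i = sum_i D_i],
    where [F] is the total disutility, [G(p) = sum_i (D_i - p_i)^2] and
    [t = 1 / (2 (N - 1) |a|)] (lemmas [nash_first_order], [nash_balance] and
    [stationary_penalized_min]). Thus an equilibrium minimizes a penalized cost
    over a feasible set that does not depend on [a], and [|a|] enters only
    through the weight [t], which decreases in [|a|]. Lowering the weight of a
    penalty lowers the other part [F] of the objective at the minimizer
    ([penalized_min_monotone]): comparing two minimizers with each other, in
    both problems, shows that [G] does not decrease, hence that [F] does not
    increase. *)

Lemma sum_with_bid (R : realType) (N : nat) (b : 'I_N -> R) (i : 'I_N) (y : R) :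
  \sum_j with_bid b i y j = \sum_j b j + (y - b i).
Proof.
rewrite (bigD1 i) //= [in RHS](bigD1 i) //= /with_bid /= eqxx.
under eq_bigr => j /negbTE ji do rewrite ji.
ring.
Qed.

Lemma sharing_price_with_bid (R : realType) (N : nat) (a : R) (b : 'I_N -> R)
    (i : 'I_N) (y : R) :
  sharing_price a (with_bid b i y)
  = sharing_price a b - (1 / (N%:R * a)) * (y - b i).
Proof. by rewrite /sharing_price sum_with_bid; ring. Qed.

Lemma sharing_price_with_own_bid (R : realType) (N : nat) (a : R)
    (b : 'I_N -> R) (i : 'I_N) :
  sharing_price a (with_bid b i (b i)) = sharing_price a b.
Proof. by rewrite sharing_price_with_bid subrr mulr0 subr0. Qed.

Lemma quadratic_ge0_linear0 (R : realType) (k A : R) :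
  0 < A -> (forall x, 0 <= k * x + A * x ^+ 2) -> k = 0.
Proof.
move=> A0 /(_ (- k / (2 * A))).
have -> : k * (- k / (2 * A)) + A * (- k / (2 * A)) ^+ 2 = - (k ^+ 2 / (4 * A)).
  by field; lra.
rewrite oppr_ge0 pmulr_lle0 ?invr_gt0 ?mulr_gt0 // => k2.
by apply/eqP; rewrite -sqrf_eq0 eq_le k2 sqr_ge0.
Qed.

(** Summing the constraints [p_i + (a lambda + b_i) = D_i] cancels the trades,
    because the price is defined so that the market clears. *)
Lemma nash_balance (R : realType) (N : nat) (a : R) (c d D p b : 'I_N -> R) :
  (0 < N)%N -> a < 0 -> nash_equilibrium a c d D p b ->
  \sum_i p i = \sum_i D i.
Proof.
move=> N0 a0 ne.
have pE i : p i = D i - a * sharing_price a b - b i.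
  have [+ _] := ne i.
  by rewrite /in_action_set sharing_price_with_own_bid => <-; ring.
rewrite (eq_bigr _ (fun i _ => pE i)) !sumrB sumr_const card_ord.
rewrite /sharing_price -mulr_natl; field.
by rewrite pnatr_eq0 -lt0n N0 lt_eqF.
Qed.

(** Raising the bid by [x] changes the price by [s x] with [s = -1 / (N a)],
    the purchase by [r x] with [r = 1 + a s = (N - 1) / N], and the own
    adjustment by [- r x]. The cost is then a quadratic function of [x] with
    its minimum at [0], and its linear coefficient gives the condition. *)
Lemma nash_first_order (R : realType) (N : nat) (a : R)
    (c d D p b : 'I_N -> R) (i : 'I_N) :
  (1 < N)%N -> a < 0 -> 0 <= c i -> nash_equilibrium a c d D p b ->
  2 * c i * p i + d i
  = sharing_price a b + (D i - p i) / ((N%:R - 1) * - a).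
Proof.
move=> N1 a0 ci0 ne.
have [+ opt] := ne i.
rewrite /in_action_set sharing_price_with_own_bid => feas.
have n1 : 1 < N%:R :> R by rewrite ltr1n.
move: opt; rewrite /player_cost sharing_price_with_own_bid.
set l := sharing_price a b in feas *.
move: n1; set n : R := N%:R => n1 opt.
pose s := - (1 / (n * a)).
pose r := 1 + a * s.
have rE : r = (n - 1) / n by rewrite /r /s; field; lra.
have s0 : 0 < s.
  by rewrite /s div1r -invrN invr_gt0 -mulrN mulr_gt0; lra.
have r0 : 0 < r by rewrite rE divr_gt0; lra.
have lE x : sharing_price a (with_bid b i (b i + x)) = l + s * x.
  by rewrite sharing_price_with_bid -/l -/n /s; ring.
have qE : D i - p i = a * l + b i by rewrite -feas; ring.
have lin0 : - r * (2 * c i * p i + d i) + r * l + s * (D i - p i) = 0.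
  apply: (@quadratic_ge0_linear0 _ _ (c i * r ^+ 2 + r * s)) => [|x].
    by rewrite ltr_wpDl ?mulr_gt0 // mulr_ge0 // sqr_ge0.
  have := opt (p i - r * x) (b i + x).
  rewrite /in_action_set lE -subr_ge0 /disutility.
  have -> : p i - r * x + a * (l + s * x) + (b i + x) = D i.
    by rewrite -feas /r; ring.
  move=> /(_ erefl); congr (0 <= _).
  by rewrite qE /r; ring.
have sr : s / r = 1 / ((n - 1) * - a) by rewrite rE /s; field; lra.
have -> : (D i - p i) / ((n - 1) * - a) = (D i - p i) * (s / r).
  by rewrite sr mulrA mulr1.
apply: (mulfI (lt0r_neq0 r0)).
have -> : r * (l + (D i - p i) * (s / r)) = r * l + s * (D i - p i).
  by field; lra.
by apply/eqP; rewrite -subr_eq0 -oppr_eq0 -lin0; apply/eqP; ring.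
Qed.

(** The objective is convex and separable, so each summand lies above its
    tangent at [p i]. All these tangents have the same slope [l], the
    multiplier of the constraint on the sum, so their increments cancel. *)
Lemma stationary_penalized_min (R : realType) (N : nat) (t l : R)
    (c d D p p' : 'I_N -> R) :
  0 <= t -> (forall i, 0 <= c i) ->
  (forall i, 2 * c i * p i + d i = l + 2 * t * (D i - p i)) ->
  \sum_i p i = \sum_i p' i ->
  total_disutility c d p + t * \sum_i (D i - p i) ^+ 2
  <= total_disutility c d p' + t * \sum_i (D i - p' i) ^+ 2.
Proof.
move=> t0 c0 foc sp.
rewrite /total_disutility !mulr_sumr -!big_split /= -subr_ge0 -sumrB.
apply: (@le_trans _ _ (\sum_i l * (p' i - p i))).
  by rewrite -mulr_sumr sumrB sp subrr mulr0.
apply: ler_sum => i _; rewrite -subr_ge0 /disutility.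
have -> : l = 2 * c i * p i + d i - 2 * t * (D i - p i) by rewrite foc; ring.
rewrite [X in 0 <= X](_ : _ = (c i + t) * (p' i - p i) ^+ 2); last by ring.
by rewrite mulr_ge0 ?sqr_ge0 ?addr_ge0.
Qed.

(** Adding the two inequalities gives [(t1 - t2) (G1 - G2) <= 0]. *)
Lemma penalized_min_monotone (R : realType) (t1 t2 F1 F2 G1 G2 : R) :
  0 <= t2 -> t2 < t1 ->
  F1 + t1 * G1 <= F2 + t1 * G2 -> F2 + t2 * G2 <= F1 + t2 * G1 ->
  F2 <= F1.
Proof.
move=> t20 t21 h1 h2.
have G12 : G1 <= G2.
  rewrite -subr_le0 -(@pmulr_rle0 _ (t1 - t2)) ?subr_gt0 //; lra.
have := ler_wpM2l t20 G12; lra.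
Qed.

Theorem proposition5 (R : realType) (N : nat) (hN : (2 <= N)%N)
  (c d D : 'I_N -> R) (cmin cmax dmin dmax Dmin Dmax : R)
  (hcmin : 0 < cmin) (hc : forall i, cmin <= c i <= cmax)
  (hdmin : 0 < dmin) (hd : forall i, dmin <= d i <= dmax)
  (hD : forall i, Dmin <= D i <= Dmax)
  (p b : R -> 'I_N -> R)
  (hNE : forall a : R, a < 0 -> nash_equilibrium a c d D (p a) (b a)) :
  forall a1 a2 : R, a1 < 0 -> a2 < 0 -> `|a1| < `|a2| ->
    total_disutility c d (p a2) <= total_disutility c d (p a1).
Proof.
move=> a1 a2 a10 a20; rewrite !ltr0_norm // => a12.
have c0 i : 0 <= c i by have /andP[/(lt_le_trans hcmin)/ltW] := hc i.
have n1 : 0 < N%:R - 1 :> R by rewrite subr_gt0 ltr1n.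
pose t a : R := 1 / (2 * ((N%:R - 1) * - a)).
have t_gt0 a : a < 0 -> 0 < t a by move=> a0; rewrite divr_gt0 ?mulr_gt0 ?oppr_gt0.
have minimal a a' : a < 0 -> a' < 0 ->
    total_disutility c d (p a) + t a * \sum_i (D i - p a i) ^+ 2
    <= total_disutility c d (p a') + t a * \sum_i (D i - p a' i) ^+ 2.
  move=> a0 a0'.
  apply: (@stationary_penalized_min _ _ _ (sharing_price a (b a))) => //.
  - exact/ltW/t_gt0.
  - move=> i; rewrite (nash_first_order hN a0 (c0 i) (hNE _ a0)).
    by congr (_ + _); rewrite /t; field; rewrite lt_eqF // lt0r_neq0.
  - rewrite (nash_balance (ltnW hN) a0 (hNE _ a0)).
    by rewrite (nash_balance (ltnW hN) a0' (hNE _ a0')).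
have t21 : t a2 < t a1.
  by rewrite /t !div1r ltf_pV2 ?posrE ?mulr_gt0 ?oppr_gt0 // !ltr_pM2l.
exact: (penalized_min_monotone (ltW (t_gt0 _ a20)) t21
  (minimal _ _ a10 a20) (minimal _ _ a20 a10)).
Qed.
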